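(* Let $M$ be a variable of type $0$ and let ''$a\in A$'' be an internal formula, with $a$ of type $1$, defining a set $A\subseteq[0,1]$ of reals. Let $L^{*}_{M}(A)\approx 0$ be the formula $$(\forall B\subseteq \mathcal{G}_{M})\Big[ (\forall E)\big( (\forall e\in E)(e\in B\wedge (\forall^{\mathrm{st}}a\in A)(a\not\approx e)) \rightarrow L_{M}^{*}(E)\approx 0 \big) \rightarrow L_{M}^{*}(B)\approx 0\Big],$$ where $E$ ranges over subsets of $\mathcal{G}_M$. Then, for nonstandard $M$, the formula $L^{*}_{M}(A)\approx 0$ is equivalent, provably in $\mathsf{P}$, to a normal form, i.e. to a formula $(\forall^{\mathrm{st}}\underline{x})(\exists^{\mathrm{st}}\underline{y})\psi(\underline{x},\underline{y})$ with $\psi$ internal and with no free variables besides those of $L^{*}_{M}(A)\approx 0$.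
   Context: The system $\mathsf{P}$. $\mathsf{E\text{-}PA}^{\omega*}$ is Peano arithmetic in all finite types with the axiom of extensionality (Gödel's system $\mathsf{T}$ with classical logic, full induction and extensionality), definitionally extended with a type $\rho^{*}$ of finite sequences of objects of type $\rho$, for each type $\rho$. Type $0$ is the type of natural numbers and type $1$ is $0\to 0$. For a sequence $Q$ of type $\rho^{*}$, $q\in Q$ means $(\exists i<|Q|)(Q(i)=_\rho q)$. The language of $\mathsf{P}$ adds a predicate $\mathrm{st}_\sigma(x)$ (''$x$ is standard'') for each finite type $\sigma$. A formula is internal if it does not involve $\mathrm{st}$. Write $(\forall^{\mathrm{st}}x)\Phi$ for $(\forall x)(\mathrm{st}(x)\rightarrow\Phi)$ and $(\exists^{\mathrm{st}}x)\Phi$ for $(\exists x)(\mathrm{st}(x)\wedge\Phi)$. The axioms of $\mathsf{P}$ are those of $\mathsf{E\text{-}PA}^{\omega*}$ together with: (1) $\mathrm{st}(x)\wedge x=y\rightarrow\mathrm{st}(y)$; $\mathrm{st}(t)$ for each closed term $t$ of $\mathsf{E\text{-}PA}^{\omega*}$; $\mathrm{st}(f)\wedge\mathrm{st}(x)\rightarrow\mathrm{st}(f(x))$. (2) External induction: $\Phi(0)\wedge(\forall^{\mathrm{st}}n^{0})(\Phi(n)\rightarrow\Phi(n+1))\rightarrow(\forall^{\mathrm{st}}n^{0})\Phi(n)$ for every formula $\Phi$. (3) Idealisation $\mathsf{I}$: $(\forall^{\mathrm{st}} x^{\sigma^{*}})(\exists y^{\tau})(\forall z^{\sigma}\in x)\varphi(z,y)\rightarrow(\exists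 y^{\tau})(\forall^{\mathrm{st}}x^{\sigma})\varphi(x,y)$ for internal $\varphi$ (parameters allowed). (4) $\mathsf{HAC}_{\mathrm{int}}$: $(\forall^{\mathrm{st}}x^{\rho})(\exists^{\mathrm{st}}y^{\tau})\varphi(x,y)\rightarrow(\exists^{\mathrm{st}}F^{\rho\to\tau^{*}})(\forall^{\mathrm{st}}x^{\rho})(\exists y^{\tau}\in F(x))\varphi(x,y)$ for internal $\varphi$ (parameters allowed). Normal form: a formula $(\forall^{\mathrm{st}}\underline{x})(\exists^{\mathrm{st}}\underline{y})\psi(\underline{x},\underline{y})$ with $\psi$ internal, where $\underline{x},\underline{y}$ are tuples of variables of finite types. Reals: a real is a fast-converging Cauchy sequence of rationals $q_{(\cdot)}$ of type $1$, i.e. $|q_n-q_{n+i}|<\frac{1}{2^n}$ for all $n,i$ (by a standard coding every type $1$ object can be viewed as a real). For reals $x,y$ given by $q_{(\cdot)},r_{(\cdot)}$, $x\approx y$ means $(\forall^{\mathrm{st}}n)(|q_n-r_n|\leq\frac{1}{2^n})$, and $x\not\approx y$ is its negation. Loeb measure: for $M$ of type $0$, $\mathcal{G}_M=\{\frac{i}{2^M}:0\leq i\leq 2^M\}$; its subsets are finite sets, coded by finite sequences. For $B\subseteq\mathcal{G}_M$, $L_M^{*}(B):=\frac{|B|}{2^M}$, where $|B|$ is the number of elements of $B$. The displayed formula expresses that every $B\subseteq\mathcal{G}_M$ that is almost included in $\mathrm{st}_M^{-1}(A)=\{b\in\mathcal{G}_M:(\exists^{\mathrm{st}}a\in A)(a\approx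 b)\}$ has infinitesimal $L_M^*(B)$, where $B$ is almost included in $D$ if $L_M^{*}(E)\approx 0$ for all $E\subseteq B\setminus D$. Here $(\forall^{\mathrm{st}}a\in A)\dots$ means $(\forall^{\mathrm{st}}a^{1})(a\in A\rightarrow\dots)$. ''Nonstandard'' means $\neg\mathrm{st}(M)$. *)

(* Defs.v *)
From Stdlib Require Import List.
Import ListNotations.

Set Implicit Arguments.
Unset Strict Implicit.
Unset Printing Implicit Defensive.

(** * Finite types, terms and formulas

    Syntax is intrinsically typed and well scoped, with de Bruijn indices: a
    term or formula lives over a context listing the types of the variables
    that may occur free in it, innermost binder first. *)

Inductive ty : Type :=
| ty0 : ty
| Arr : ty -> ty -> ty
| Seq : ty -> ty.

Declare Scope ty_scope.
Delimit Scope ty_scope with ty.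
Bind Scope ty_scope with ty.
Notation "s ⇒ t" := (Arr s t) (at level 60, right associativity) : ty_scope.
Open Scope ty_scope.

Definition ty1 : ty := ty0 ⇒ ty0.

Definition ctx := list ty.

Inductive var : ctx -> ty -> Type :=
| vz : forall (Γ : ctx) (σ : ty), var (σ :: Γ) σ
| vs : forall (Γ : ctx) (σ τ : ty), var Γ τ -> var (σ :: Γ) τ.

Arguments vz {Γ σ}.
Arguments vs {Γ σ τ} x.

Fixpoint idx (Γ : ctx) (σ : ty) (x : var Γ σ) : nat :=
  match x with
  | vz => 0
  | vs y => S (idx y)
  end.

(** [Rec] and [LRec] take the number (resp. sequence) first, then the base
    value, then a step applied to the previous value and to the predecessor
    (resp. the head). *)
Inductive tm (Γ : ctx) : ty -> Type :=
| Var : forall σ, var Γ σ -> tm Γ σ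
| App : forall σ τ, tm Γ (σ ⇒ τ) -> tm Γ σ -> tm Γ τ
| Lam : forall σ τ, tm (σ :: Γ) τ -> tm Γ (σ ⇒ τ)
| Zero : tm Γ ty0
| Succ : tm Γ (ty0 ⇒ ty0)
| Rec : forall ρ, tm Γ (ty0 ⇒ ρ ⇒ (ρ ⇒ ty0 ⇒ ρ) ⇒ ρ)
| Nil : forall σ, tm Γ (Seq σ)
| Cons : forall σ, tm Γ (σ ⇒ Seq σ ⇒ Seq σ)
| LRec : forall σ ρ, tm Γ (Seq σ ⇒ ρ ⇒ (ρ ⇒ σ ⇒ ρ) ⇒ ρ).

Arguments Var {Γ σ} x.
Arguments App {Γ σ τ} s t.
Arguments Lam {Γ σ τ} t.
Arguments Zero {Γ}.
Arguments Succ {Γ}.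
Arguments Rec {Γ ρ}.
Arguments Nil {Γ σ}.
Arguments Cons {Γ σ}.
Arguments LRec {Γ σ ρ}.

Notation "s · t" := (App s t) (at level 40, left associativity).
Notation v0 := (Var vz).
Notation v1 := (Var (vs vz)).
Notation v2 := (Var (vs (vs vz))).
Notation v3 := (Var (vs (vs (vs vz)))).
Notation v4 := (Var (vs (vs (vs (vs vz))))).

Inductive fm (Γ : ctx) : Type :=
| Bot : fm Γ
| Eq : forall σ, tm Γ σ -> tm Γ σ -> fm Γ
| St : forall σ, tm Γ σ -> fm Γ
| Imp : fm Γ -> fm Γ -> fm Γ
| And : fm Γ -> fm Γ -> fm Γ
| Or : fm Γ -> fm Γ -> fm Γ
| All : forall σ, fm (σ :: Γ) -> fm Γ
| Ex : forall σ, fm (σ :: Γ) -> fm Γ.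

Arguments Bot {Γ}.
Arguments Eq {Γ σ} s t.
Arguments St {Γ σ} t.
Arguments Imp {Γ} φ ψ.
Arguments And {Γ} φ ψ.
Arguments Or {Γ} φ ψ.
Arguments All {Γ} σ φ.
Arguments Ex {Γ} σ φ.

Definition Neg {Γ} (φ : fm Γ) : fm Γ := Imp φ Bot.
Definition Iff {Γ} (φ ψ : fm Γ) : fm Γ := And (Imp φ ψ) (Imp ψ φ).
Definition AllSt {Γ} (σ : ty) (φ : fm (σ :: Γ)) : fm Γ := All σ (Imp (St v0) φ).
Definition ExSt {Γ} (σ : ty) (φ : fm (σ :: Γ)) : fm Γ := Ex σ (And (St v0) φ).

Arguments AllSt {Γ} σ φ.
Arguments ExSt {Γ} σ φ.

Fixpoint internal (Γ : ctx) (φ : fm Γ) : Prop :=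
  match φ with
  | Bot => True
  | Eq _ _ => True
  | St _ => False
  | Imp φ ψ | And φ ψ | Or φ ψ => internal φ /\ internal ψ
  | All _ φ | Ex _ φ => internal φ
  end.

Fixpoint occurs (n : nat) (Γ : ctx) (σ : ty) (t : tm Γ σ) : Prop :=
  match t with
  | Var x => idx x = n
  | App s t => occurs n s \/ occurs n t
  | Lam t => occurs (S n) t
  | Zero | Succ | Rec | Nil | Cons | LRec => False
  end.

(** [free n φ]: the variable with index [n] occurs free in [φ]. *)
Fixpoint free (n : nat) (Γ : ctx) (φ : fm Γ) : Prop :=
  match φ with
  | Bot => False
  | Eq s t => occurs n s \/ occurs n t
  | St t => occurs n t
  | Imp φ ψ | And φ ψ | Or φ ψ => free n φ \/ free n ψ
  | All _ φ | Ex _ φ => free (S n) φ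
  end.

(** * Renaming and substitution *)

Definition ren (Γ Δ : ctx) := forall σ, var Γ σ -> var Δ σ.
Definition sub (Γ Δ : ctx) := forall σ, var Γ σ -> tm Δ σ.

Definition scons {Γ : ctx} {σ : ty} {T : ty -> Type}
    (t : T σ) (f : forall τ, var Γ τ -> T τ) (τ : ty) (x : var (σ :: Γ) τ) : T τ :=
  match x in var Δ τ'
    return match Δ with
           | [] => unit
           | a :: Γ' => T a -> (forall τ, var Γ' τ -> T τ) -> T τ'
           end
  with
  | vz => fun t _ => t
  | vs y => fun _ f => f _ y
  end t f.

Definition no_vars (Γ : ctx) : ren [] Γ :=
  fun σ x => match x in var Δ _ return match Δ with [] => var Γ σ | _ => unit end with
             | vz => tt
             | vs _ => tt
             end.

Definition shift {Γ : ctx} {σ : ty} : ren Γ (σ :: Γ) := fun _ x => vs x.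

Definition up_ren {Γ Δ : ctx} {σ : ty} (r : ren Γ Δ) : ren (σ :: Γ) (σ :: Δ) :=
  scons (T := var (σ :: Δ)) vz (fun τ x => vs (r τ x)).

Fixpoint ren_tm {Γ Δ : ctx} {σ : ty} (r : ren Γ Δ) (t : tm Γ σ) : tm Δ σ :=
  match t with
  | Var x => Var (r _ x)
  | App s t => App (ren_tm r s) (ren_tm r t)
  | Lam t => Lam (ren_tm (up_ren r) t)
  | Zero => Zero
  | Succ => Succ
  | Rec => Rec
  | Nil => Nil
  | Cons => Cons
  | LRec => LRec
  end.

Fixpoint ren_fm {Γ Δ : ctx} (r : ren Γ Δ) (φ : fm Γ) : fm Δ :=
  match φ with
  | Bot => Bot
  | Eq s t => Eq (ren_tm r s) (ren_tm r t)
  | St t => St (ren_tm r t)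
  | Imp φ ψ => Imp (ren_fm r φ) (ren_fm r ψ)
  | And φ ψ => And (ren_fm r φ) (ren_fm r ψ)
  | Or φ ψ => Or (ren_fm r φ) (ren_fm r ψ)
  | All σ φ => All σ (ren_fm (up_ren r) φ)
  | Ex σ φ => Ex σ (ren_fm (up_ren r) φ)
  end.

Definition wk {Γ : ctx} {σ τ : ty} (t : tm Γ τ) : tm (σ :: Γ) τ := ren_tm shift t.
Definition wkf {Γ : ctx} {σ : ty} (φ : fm Γ) : fm (σ :: Γ) := ren_fm shift φ.

Definition up_sub {Γ Δ : ctx} {σ : ty} (s : sub Γ Δ) : sub (σ :: Γ) (σ :: Δ) :=
  scons (T := tm (σ :: Δ)) v0 (fun τ x => wk (s τ x)).

Fixpoint sub_tm {Γ Δ : ctx} {σ : ty} (f : sub Γ Δ) (t : tm Γ σ) : tm Δ σ :=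
  match t with
  | Var x => f _ x
  | App s t => App (sub_tm f s) (sub_tm f t)
  | Lam t => Lam (sub_tm (up_sub f) t)
  | Zero => Zero
  | Succ => Succ
  | Rec => Rec
  | Nil => Nil
  | Cons => Cons
  | LRec => LRec
  end.

Fixpoint sub_fm {Γ Δ : ctx} (f : sub Γ Δ) (φ : fm Γ) : fm Δ :=
  match φ with
  | Bot => Bot
  | Eq s t => Eq (sub_tm f s) (sub_tm f t)
  | St t => St (sub_tm f t)
  | Imp φ ψ => Imp (sub_fm f φ) (sub_fm f ψ)
  | And φ ψ => And (sub_fm f φ) (sub_fm f ψ)
  | Or φ ψ => Or (sub_fm f φ) (sub_fm f ψ)
  | All σ φ => All σ (sub_fm (up_sub f) φ)
  | Ex σ φ => Ex σ (sub_fm (up_sub f) φ)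
  end.

Definition inst_tm {Γ : ctx} {σ τ : ty} (t : tm (σ :: Γ) τ) (u : tm Γ σ) : tm Γ τ :=
  sub_tm (scons (T := tm Γ) u (fun _ x => Var x)) t.

Definition inst {Γ : ctx} {σ : ty} (φ : fm (σ :: Γ)) (u : tm Γ σ) : fm Γ :=
  sub_fm (scons (T := tm Γ) u (fun _ x => Var x)) φ.

(** [φ(n+1)], for [φ(n)] with distinguished variable [n]. *)
Definition at_succ {Γ : ctx} (φ : fm (ty0 :: Γ)) : fm (ty0 :: Γ) :=
  sub_fm (scons (T := tm (ty0 :: Γ)) (Succ · v0) (fun _ x => Var (vs x))) φ.

(** * Arithmetic and finite sequences as closed terms

    Truth values are [0] (false) and [1] (true). *)

Definition one {Γ} : tm Γ ty0 := Succ · Zero.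

Definition pred_t {Γ} : tm Γ (ty0 ⇒ ty0) := Lam (Rec · v0 · Zero · Lam (Lam v0)).
Definition add_t {Γ} : tm Γ (ty0 ⇒ ty0 ⇒ ty0) :=
  Lam (Lam (Rec · v0 · v1 · Lam (Lam (Succ · v1)))).
(** Truncated subtraction. *)
Definition sub_t {Γ} : tm Γ (ty0 ⇒ ty0 ⇒ ty0) :=
  Lam (Lam (Rec · v0 · v1 · Lam (Lam (pred_t · v1)))).
Definition mul_t {Γ} : tm Γ (ty0 ⇒ ty0 ⇒ ty0) :=
  Lam (Lam (Rec · v0 · Zero · Lam (Lam (add_t · v1 · v3)))).
Definition pow2 {Γ} : tm Γ (ty0 ⇒ ty0) :=
  Lam (Rec · v0 · one · Lam (Lam (add_t · v1 · v1))).
Definition iszero {Γ} : tm Γ (ty0 ⇒ ty0) :=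
  Lam (Rec · v0 · one · Lam (Lam Zero)).
(** [cond b x y] is [x] if [b] is nonzero and [y] otherwise. *)
Definition cond {Γ} : tm Γ (ty0 ⇒ ty0 ⇒ ty0 ⇒ ty0) :=
  Lam (Lam (Lam (Rec · v2 · v0 · Lam (Lam v3)))).
Definition leb_t {Γ} : tm Γ (ty0 ⇒ ty0 ⇒ ty0) :=
  Lam (Lam (iszero · (sub_t · v1 · v0))).
Definition ltb_t {Γ} : tm Γ (ty0 ⇒ ty0 ⇒ ty0) :=
  Lam (Lam (leb_t · (Succ · v1) · v0)).
Definition eqb_t {Γ} : tm Γ (ty0 ⇒ ty0 ⇒ ty0) :=
  Lam (Lam (mul_t · (leb_t · v1 · v0) · (leb_t · v0 · v1))).
(** [forall k < n, p k] and [exists k < n, p k]. *)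
Definition ball {Γ} : tm Γ ((ty0 ⇒ ty0) ⇒ ty0 ⇒ ty0) :=
  Lam (Lam (Rec · v0 · one · Lam (Lam (mul_t · v1 · (v3 · v0))))).
Definition bex {Γ} : tm Γ ((ty0 ⇒ ty0) ⇒ ty0 ⇒ ty0) :=
  Lam (Lam (Rec · v0 · Zero · Lam (Lam (cond · v1 · one · (v3 · v0))))).
(** The largest [k <= n] with [p k], or [0] if there is none. *)
Definition bmax {Γ} : tm Γ ((ty0 ⇒ ty0) ⇒ ty0 ⇒ ty0) :=
  Lam (Lam (Rec · v0 · Zero ·
    Lam (Lam (cond · (v3 · (Succ · v0)) · (Succ · v0) · v1)))).
Definition parity {Γ} : tm Γ (ty0 ⇒ ty0) :=
  Lam (Rec · v0 · Zero · Lam (Lam (iszero · v1))).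
Definition half {Γ} : tm Γ (ty0 ⇒ ty0) :=
  Lam (Rec · v0 · Zero · Lam (Lam (add_t · v1 · (parity · v0)))).

Fixpoint dflt {Γ : ctx} (σ : ty) : tm Γ σ :=
  match σ with
  | ty0 => Zero
  | Arr _ τ => Lam (dflt τ)
  | Seq _ => Nil
  end.

(** [|Q|] and [Q(i)]; out of range, [Q(i)] is the zero functional. *)
Definition len {Γ : ctx} {σ : ty} : tm Γ (Seq σ ⇒ ty0) :=
  Lam (LRec · v0 · Zero · Lam (Lam (Succ · v1))).
Definition item {Γ : ctx} {σ : ty} : tm Γ (Seq σ ⇒ ty0 ⇒ σ) :=
  Lam (LRec · v0 · Lam (dflt σ) ·
    Lam (Lam (Lam (Rec · v0 · v1 · Lam (Lam (v4 · v0)))))).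

(** The number of elements of the set coded by [Q], i.e. the number of
    [i < |Q|] with [Q(j) <> Q(i)] for all [j < i]. *)
Definition card {Γ} : tm Γ (Seq ty0 ⇒ ty0) :=
  Lam (Rec · (len · v0) · Zero ·
    Lam (Lam (add_t · v1 ·
      (iszero · (bex · Lam (eqb_t · (item · v3 · v0) · (item · v3 · v1)) · v0))))).

(** * Rational numbers

    Cantor pairing [j(x,y) = (x+y)(x+y+1)/2 + x] with projections [j1], [j2].
    The code [j(p,d)] stands for the rational [k/(d+1)], where [k] is [p/2] if
    [p] is even and [-(p+1)/2] if [p] is odd; every number is a code. *)

Definition tri {Γ} : tm Γ (ty0 ⇒ ty0) :=
  Lam (Rec · v0 · Zero · Lam (Lam (add_t · v1 · (Succ · v0)))).
Definition jpair {Γ} : tm Γ (ty0 ⇒ ty0 ⇒ ty0) :=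
  Lam (Lam (add_t · (tri · (add_t · v1 · v0)) · v1)).
Definition j1 {Γ} : tm Γ (ty0 ⇒ ty0) :=
  Lam (bmax · Lam (bex · Lam (eqb_t · (jpair · v1 · v0) · v2) · (Succ · v1)) · v0).
Definition j2 {Γ} : tm Γ (ty0 ⇒ ty0) :=
  Lam (bmax · Lam (bex · Lam (eqb_t · (jpair · v0 · v1) · v2) · (Succ · v1)) · v0).

(** The rational [q] is [(qpos q - qneg q) / qden q]. *)
Definition qpos {Γ} : tm Γ (ty0 ⇒ ty0) :=
  Lam (cond · (parity · (j1 · v0)) · Zero · (half · (j1 · v0))).
Definition qneg {Γ} : tm Γ (ty0 ⇒ ty0) :=
  Lam (cond · (parity · (j1 · v0)) · (half · (Succ · (j1 · v0))) · Zero).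
Definition qden {Γ} : tm Γ (ty0 ⇒ ty0) := Lam (Succ · (j2 · v0)).

(** [qmk a b d] codes [(a - b)/d], for [d > 0]. *)
Definition qmk {Γ} : tm Γ (ty0 ⇒ ty0 ⇒ ty0 ⇒ ty0) :=
  Lam (Lam (Lam (jpair ·
    (cond · (leb_t · v1 · v2)
      · (add_t · (sub_t · v2 · v1) · (sub_t · v2 · v1))
      · (pred_t · (add_t · (sub_t · v1 · v2) · (sub_t · v1 · v2))))
    · (pred_t · v0)))).

(** [qfrac a d] codes [a/d], for [d > 0]. *)
Definition qfrac {Γ} : tm Γ (ty0 ⇒ ty0 ⇒ ty0) := Lam (Lam (qmk · v1 · Zero · v0)).
Definition qadd {Γ} : tm Γ (ty0 ⇒ ty0 ⇒ ty0) :=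
  Lam (Lam (qmk
    · (add_t · (mul_t · (qpos · v1) · (qden · v0)) · (mul_t · (qpos · v0) · (qden · v1)))
    · (add_t · (mul_t · (qneg · v1) · (qden · v0)) · (mul_t · (qneg · v0) · (qden · v1)))
    · (mul_t · (qden · v1) · (qden · v0)))).
Definition qopp {Γ} : tm Γ (ty0 ⇒ ty0) :=
  Lam (qmk · (qneg · v0) · (qpos · v0) · (qden · v0)).
Definition qsub {Γ} : tm Γ (ty0 ⇒ ty0 ⇒ ty0) := Lam (Lam (qadd · v1 · (qopp · v0))).
Definition qabs {Γ} : tm Γ (ty0 ⇒ ty0) :=
  Lam (qfrac · (add_t · (qpos · v0) · (qneg · v0)) · (qden · v0)).
Definition qleb {Γ} : tm Γ (ty0 ⇒ ty0 ⇒ ty0) :=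
  Lam (Lam (leb_t
    · (add_t · (mul_t · (qpos · v1) · (qden · v0)) · (mul_t · (qneg · v0) · (qden · v1)))
    · (add_t · (mul_t · (qpos · v0) · (qden · v1)) · (mul_t · (qneg · v1) · (qden · v0))))).
Definition qltb {Γ} : tm Γ (ty0 ⇒ ty0 ⇒ ty0) := Lam (Lam (iszero · (qleb · v0 · v1))).

Definition qzero {Γ} : tm Γ ty0 := qfrac · Zero · one.
Definition qone {Γ} : tm Γ ty0 := qfrac · one · one.

(** * Real numbers

    Every type 1 object [f] is viewed as the real [hat f], where
    [hat f n = f k] for the largest [k <= n] such that
    [|f m - f m'| < 1/2^m] whenever [m <= m' <= k].  Thus [hat f] is always
    fast converging, and [hat f = f] if [f] already is. *)
Definition hat {Γ} : tm Γ (ty1 ⇒ ty1) :=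
  Lam (Lam (v1 · (bmax ·
    Lam (ball ·
      Lam (ball ·
        Lam (qltb · (qabs · (qsub · (v4 · v0) · (v4 · v1))) · (qfrac · one · (pow2 · v0)))
        · (Succ · v0))
      · (Succ · v0))
    · v0))).

Definition constseq {Γ : ctx} (q : tm Γ ty0) : tm Γ ty1 := Lam (wk q).

(** * Formulas of arithmetic and analysis *)

Definition Lt {Γ : ctx} (s t : tm Γ ty0) : fm Γ :=
  Ex ty0 (Eq (add_t · wk s · (Succ · v0)) (wk t)).
Definition Le {Γ : ctx} (s t : tm Γ ty0) : fm Γ :=
  Ex ty0 (Eq (add_t · wk s · v0) (wk t)).

Definition Mem {Γ : ctx} {σ : ty} (q : tm Γ σ) (Q : tm Γ (Seq σ)) : fm Γ :=
  Ex ty0 (And (Lt v0 (len · wk Q)) (Eq (item · wk Q · v0) (wk q))).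

Definition Qle {Γ : ctx} (q r : tm Γ ty0) : fm Γ := Eq (qleb · q · r) one.

(** If [q] and [r] are fast converging to [x] and [y], then [x <= y] holds iff
    [q n <= r n + 2/2^n] for all [n]. *)
Definition Rle {Γ : ctx} (x y : tm Γ ty1) : fm Γ :=
  All ty0 (Qle (hat · wk x · v0)
              (qadd · (hat · wk y · v0) · (qfrac · (Succ · one) · (pow2 · v0)))).

Definition Approx {Γ : ctx} (x y : tm Γ ty1) : fm Γ :=
  AllSt ty0 (Qle (qabs · (qsub · (hat · wk x · v0) · (hat · wk y · v0)))
                (qfrac · one · (pow2 · v0))).

(** * The system P *)

Inductive EPA_axiom (Γ : ctx) : fm Γ -> Prop :=
| ax_refl : forall σ (t : tm Γ σ), EPA_axiom (Eq t t)
| ax_subst : forall σ (φ : fm (σ :: Γ)) (s t : tm Γ σ), internal φ ->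
    EPA_axiom (Imp (Eq s t) (Imp (inst φ s) (inst φ t)))
| ax_ext : forall σ τ (f g : tm Γ (σ ⇒ τ)),
    EPA_axiom (Imp (All σ (Eq (wk f · v0) (wk g · v0))) (Eq f g))
| ax_beta : forall σ τ (t : tm (σ :: Γ) τ) (u : tm Γ σ),
    EPA_axiom (Eq (Lam t · u) (inst_tm t u))
| ax_succ_nonzero : forall t : tm Γ ty0, EPA_axiom (Neg (Eq (Succ · t) Zero))
| ax_succ_inj : forall s t : tm Γ ty0,
    EPA_axiom (Imp (Eq (Succ · s) (Succ · t)) (Eq s t))
| ax_rec_zero : forall ρ (y : tm Γ ρ) (z : tm Γ (ρ ⇒ ty0 ⇒ ρ)),
    EPA_axiom (Eq (Rec · Zero · y · z) y)
| ax_rec_succ : forall ρ (n : tm Γ ty0) (y : tm Γ ρ) (z : tm Γ (ρ ⇒ ty0 ⇒ ρ)),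
    EPA_axiom (Eq (Rec · (Succ · n) · y · z) (z · (Rec · n · y · z) · n))
| ax_induction : forall φ : fm (ty0 :: Γ), internal φ ->
    EPA_axiom (Imp (And (inst φ Zero) (All ty0 (Imp φ (at_succ φ)))) (All ty0 φ))
| ax_seq : forall σ (Q : tm Γ (Seq σ)),
    EPA_axiom (Or (Eq Q Nil)
                  (Ex σ (Ex (Seq σ) (Eq (wk (wk Q)) (Cons · v1 · v0)))))
| ax_lrec_nil : forall σ ρ (y : tm Γ ρ) (z : tm Γ (ρ ⇒ σ ⇒ ρ)),
    EPA_axiom (Eq (LRec · Nil · y · z) y)
| ax_lrec_cons : forall σ ρ (a : tm Γ σ) (Q : tm Γ (Seq σ))
    (y : tm Γ ρ) (z : tm Γ (ρ ⇒ σ ⇒ ρ)),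
    EPA_axiom (Eq (LRec · (Cons · a · Q) · y · z) (z · (LRec · Q · y · z) · a)).

Inductive P_axiom (Γ : ctx) : fm Γ -> Prop :=
| ax_EPA : forall φ, EPA_axiom φ -> P_axiom φ
| ax_st_eq : forall σ (x y : tm Γ σ), P_axiom (Imp (And (St x) (Eq x y)) (St y))
| ax_st_closed : forall σ (t : tm [] σ), P_axiom (St (ren_tm (no_vars Γ) t))
| ax_st_app : forall σ τ (f : tm Γ (σ ⇒ τ)) (x : tm Γ σ),
    P_axiom (Imp (And (St f) (St x)) (St (f · x)))
| ax_external_induction : forall φ : fm (ty0 :: Γ),
    P_axiom (Imp (And (inst φ Zero) (AllSt ty0 (Imp φ (at_succ φ)))) (AllSt ty0 φ))
| ax_idealisation : forall σ τ (φ : fm (σ :: τ :: Γ)), internal φ ->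
    P_axiom (Imp (AllSt (Seq σ) (Ex τ (All σ
                   (Imp (Mem v0 v2) (ren_fm (up_ren (up_ren shift)) φ)))))
                 (Ex τ (AllSt σ φ)))
| ax_HAC_int : forall ρ τ (φ : fm (τ :: ρ :: Γ)), internal φ ->
    P_axiom (Imp (AllSt ρ (ExSt τ φ))
                 (ExSt (ρ ⇒ Seq τ) (AllSt ρ (Ex τ
                   (And (Mem v0 (v2 · v1)) (ren_fm (up_ren (up_ren shift)) φ)))))).

(** Classical natural deduction; [prv H φ]: the system P proves [φ] from the
    hypotheses [H]. *)
Inductive prv : forall Γ : ctx, list (fm Γ) -> fm Γ -> Prop :=
| prv_axiom : forall Γ (H : list (fm Γ)) φ, P_axiom φ -> prv H φ
| prv_hyp : forall Γ (H : list (fm Γ)) φ, In φ H -> prv H φ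
| prv_impI : forall Γ (H : list (fm Γ)) φ ψ, prv (φ :: H) ψ -> prv H (Imp φ ψ)
| prv_impE : forall Γ (H : list (fm Γ)) φ ψ, prv H (Imp φ ψ) -> prv H φ -> prv H ψ
| prv_andI : forall Γ (H : list (fm Γ)) φ ψ, prv H φ -> prv H ψ -> prv H (And φ ψ)
| prv_andE1 : forall Γ (H : list (fm Γ)) φ ψ, prv H (And φ ψ) -> prv H φ
| prv_andE2 : forall Γ (H : list (fm Γ)) φ ψ, prv H (And φ ψ) -> prv H ψ
| prv_orI1 : forall Γ (H : list (fm Γ)) φ ψ, prv H φ -> prv H (Or φ ψ)
| prv_orI2 : forall Γ (H : list (fm Γ)) φ ψ, prv H ψ -> prv H (Or φ ψ)
| prv_orE : forall Γ (H : list (fm Γ)) φ ψ χ,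
    prv H (Or φ ψ) -> prv (φ :: H) χ -> prv (ψ :: H) χ -> prv H χ
| prv_raa : forall Γ (H : list (fm Γ)) φ, prv (Neg φ :: H) Bot -> prv H φ
| prv_allI : forall Γ (H : list (fm Γ)) σ (φ : fm (σ :: Γ)),
    prv (map wkf H) φ -> prv H (All σ φ)
| prv_allE : forall Γ (H : list (fm Γ)) σ (φ : fm (σ :: Γ)) (t : tm Γ σ),
    prv H (All σ φ) -> prv H (inst φ t)
| prv_exI : forall Γ (H : list (fm Γ)) σ (φ : fm (σ :: Γ)) (t : tm Γ σ),
    prv H (inst φ t) -> prv H (Ex σ φ)
| prv_exE : forall Γ (H : list (fm Γ)) σ (φ : fm (σ :: Γ)) χ,
    prv H (Ex σ φ) -> prv (φ :: map wkf H) (wkf χ) -> prv H χ.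

(** * Normal forms *)

(** Quantification over a tuple of standard objects; the last variable of the
    tuple is the head of the list of types. *)
Fixpoint AllSts {Γ : ctx} (Δ : list ty) : fm (Δ ++ Γ) -> fm Γ :=
  match Δ with
  | [] => fun φ => φ
  | σ :: Δ => fun φ => AllSts (AllSt σ φ)
  end.

Fixpoint ExSts {Γ : ctx} (Δ : list ty) : fm (Δ ++ Γ) -> fm Γ :=
  match Δ with
  | [] => fun φ => φ
  | σ :: Δ => fun φ => ExSts (ExSt σ φ)
  end.

Definition normal_form {Γ : ctx} (φ : fm Γ) : Prop :=
  exists (X Y : list ty) (ψ : fm (Y ++ (X ++ Γ))),
    internal ψ /\ φ = AllSts (ExSts ψ).

(** * Loeb measure *)

(** Elements of the grid [G_M] are codes [i/2^M]; a subset of it is coded by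
    a sequence of such codes, in any order and possibly with repetitions. *)
Definition InGrid {Γ : ctx} (M q : tm Γ ty0) : fm Γ :=
  Ex ty0 (And (Le v0 (pow2 · wk M)) (Eq (wk q) (qfrac · v0 · (pow2 · wk M)))).

Definition SubGrid {Γ : ctx} (M : tm Γ ty0) (B : tm Γ (Seq ty0)) : fm Γ :=
  All ty0 (Imp (Mem v0 (wk B)) (InGrid (wk M) v0)).

(** [L_M^*(B) ≈ 0] for [B] a subset of the grid. *)
Definition MeasInf {Γ : ctx} (M : tm Γ ty0) (B : tm Γ (Seq ty0)) : fm Γ :=
  Approx (constseq (qfrac · (card · B) · (pow2 · M))) (constseq qzero).

(** [L_M^*(A) ≈ 0]; the bound variables are [B], [E], [e], [a] in this order. *)
Definition LoebNull {Γ : ctx} (A : fm (ty1 :: Γ)) (M : tm Γ ty0) : fm Γ :=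
  All (Seq ty0) (Imp (SubGrid (wk M) v0) (Imp
    (All (Seq ty0) (Imp (SubGrid (wk (wk M)) v0) (Imp
      (All ty0 (Imp (Mem v0 v1)
        (And (Mem v0 v2)
             (AllSt ty1 (Imp (ren_fm (up_ren (fun _ x => vs (vs (vs x)))) A)
                            (Neg (Approx v0 (constseq v1))))))))
      (MeasInf (wk (wk M)) v0))))
    (MeasInf (wk M) v0))).

(** The set of reals defined by [A] is a subset of [0,1]. *)
Definition SubUnit {Γ : ctx} (A : fm (ty1 :: Γ)) : fm Γ :=
  All ty1 (Imp A (And (Rle (constseq qzero) v0) (Rle v0 (constseq qone)))).

(* Main.v *)
Require Import Defs.
From Stdlib Require Import List FunctionalExtensionality Setoid Morphisms.
Import ListNotations.

Set Implicit Arguments.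
Unset Strict Implicit.
Unset Printing Implicit Defensive.

(** In P every formula, however many standardness predicates it contains, is
    equivalent to a normal form with no further free variables; the formula
    expressing that a set has Loeb measure zero is one instance.

    The proof is by induction on formulas ([formula_has_nf]).  In the induction
    the normal forms have the shape [∀st x ∃st y ψ] with one variable of each
    kind.  Classically it is enough to treat negation, disjunction and the
    universal quantifier.

    - Negation ([has_nf_neg]): by [HAC_int], [∀st x ∃st y ψ] is equivalent to
      [∃st F ∀st x ∃y ∈ F(x) ψ], and negating this gives
      [∀st F ∃st x ¬ ∃y ∈ F(x) ψ].
    - Universal quantifier ([has_nf_all]): by idealisation, read
      contrapositively, [∀z ∃st y ψ] is equivalent to [∃st s ∀z ∃y ∈ s ψ].
    - Disjunction ([has_nf_or]): the two standard universal variables, and the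
      two standard existential ones, are merged into a single one by pairing
      ([pairing]).

    The converse implications in the first two items need that an element of a
    standard sequence is standard ([st_mem]); this follows by external induction
    from the fact that a number below a standard one is standard ([st_below]).

    There are no product types, so pairs are coded.  If [σ] and [τ] are both
    retracts of [ρ], a pair is a function [0 ⇒ ρ] carrying one component at [0]
    and the other elsewhere; such a [ρ] exists for all [σ] and [τ]
    ([retract_join]). *)

(** * Calculus of substitutions *)

(** Renamings, instantiations and weakenings are all brought to one form, a
    substitution [t1 .: t2 .: ... .: ↑ >> ... >> ↑], on which the equations of
    the sigma calculus decide equality in practice. *)
Definition ids {Γ : ctx} : sub Γ Γ := fun _ x => Var x.
Definition shift_sub {Γ : ctx} {σ : ty} : sub Γ (σ :: Γ) := fun _ x => Var (vs x).
Definition ren_sub {Γ Δ : ctx} (r : ren Γ Δ) : sub Γ Δ := fun _ x => Var (r _ x).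
Definition comp {Γ Δ Θ : ctx} (f : sub Γ Δ) (g : sub Δ Θ) : sub Γ Θ :=
  fun _ x => sub_tm g (f _ x).

Arguments ids {Γ} _ x /.
Arguments shift_sub {Γ σ} _ x /.
Arguments ren_sub {Γ Δ} r _ x /.
Arguments comp {Γ Δ Θ} f g _ x /.

Notation "t .: f" := (scons (T := tm _) t f) (at level 55, right associativity).
Notation "f >> g" := (comp f g) (at level 50, left associativity).
Notation "↑" := shift_sub.

(** The return clause is generalised over the context, since a direct match on
    [var (σ :: Γ) τ] would have to equate indices. *)
Definition var_case {Γ : ctx} {σ : ty} (P : forall τ, var (σ :: Γ) τ -> Prop)
    (z : P σ vz) (s : forall τ (x : var Γ τ), P τ (vs x)) (τ : ty)
    (x : var (σ :: Γ) τ) : P τ x :=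
  match x in var Δ τ'
    return match Δ return var Δ τ' -> Prop with
           | [] => fun _ => True
           | a :: Γ' => fun x => forall P : forall τ, var (a :: Γ') τ -> Prop,
               P a vz -> (forall τ (y : var Γ' τ), P τ (vs y)) -> P τ' x
           end x
  with
  | vz => fun P z _ => z
  | vs y => fun P _ s => s _ y
  end P z s.

Ltac var_cases :=
  repeat (refine (var_case (P := fun _ _ => _) _ _); [cbn; try discriminate |]); cbn.

Lemma sub_ext {Γ Δ} (f g : sub Γ Δ) : (forall σ x, f σ x = g σ x) -> f = g.
Proof.
  intro h; apply functional_extensionality_dep; intro σ.
  apply functional_extensionality; apply h.
Qed.

Lemma sub_ext_cons {Γ Δ σ} (f g : sub (σ :: Γ) Δ) :
  f _ vz = g _ vz -> (forall τ x, f τ (vs x) = g τ (vs x)) -> f = g.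
Proof.
  intros hz hs; apply sub_ext; apply var_case; assumption.
Qed.

Lemma ren_ext_cons {Γ Δ σ} (f g : ren (σ :: Γ) Δ) :
  f _ vz = g _ vz -> (forall τ x, f τ (vs x) = g τ (vs x)) -> f = g.
Proof.
  intros hz hs; apply functional_extensionality_dep; intro τ.
  apply functional_extensionality; revert τ; apply var_case; assumption.
Qed.

Lemma up_ren_sub {Γ Δ σ} (r : ren Γ Δ) :
  ren_sub (up_ren (σ := σ) r) = up_sub (ren_sub r).
Proof. apply sub_ext_cons; reflexivity. Qed.

Lemma ren_tm_sub {Γ σ} (t : tm Γ σ) : forall Δ (r : ren Γ Δ),
  ren_tm r t = sub_tm (ren_sub r) t.
Proof.
  induction t; intros; cbn; try reflexivity; [now rewrite IHt1, IHt2|].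
  now rewrite IHt, up_ren_sub.
Qed.

Lemma ren_fm_sub {Γ} (φ : fm Γ) : forall Δ (r : ren Γ Δ),
  ren_fm r φ = sub_fm (ren_sub r) φ.
Proof.
  induction φ; intros; cbn; rewrite ?ren_tm_sub, ?IHφ1, ?IHφ2, ?IHφ, ?up_ren_sub; reflexivity.
Qed.

Lemma ren_ren_tm {Γ σ} (t : tm Γ σ) : forall Δ Θ (r : ren Γ Δ) (r' : ren Δ Θ),
  ren_tm r' (ren_tm r t) = ren_tm (fun τ x => r' _ (r τ x)) t.
Proof.
  induction t; intros; cbn; try reflexivity; [now rewrite IHt1, IHt2|].
  rewrite IHt; do 2 f_equal; apply ren_ext_cons; reflexivity.
Qed.

Lemma sub_ren_tm {Γ σ} (t : tm Γ σ) : forall Δ Θ (r : ren Γ Δ) (f : sub Δ Θ),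
  sub_tm f (ren_tm r t) = sub_tm (fun τ x => f _ (r τ x)) t.
Proof.
  induction t; intros; cbn; try reflexivity; [now rewrite IHt1, IHt2|].
  rewrite IHt; do 2 f_equal; apply sub_ext_cons; reflexivity.
Qed.

Lemma ren_sub_tm {Γ σ} (t : tm Γ σ) : forall Δ Θ (f : sub Γ Δ) (r : ren Δ Θ),
  ren_tm r (sub_tm f t) = sub_tm (fun τ x => ren_tm r (f τ x)) t.
Proof.
  induction t; intros; cbn; try reflexivity; [now rewrite IHt1, IHt2|].
  rewrite IHt; do 2 f_equal; apply sub_ext_cons; try reflexivity.
  intros; cbn; unfold wk; now rewrite !ren_ren_tm.
Qed.

Lemma up_comp {Γ Δ Θ σ} (f : sub Γ Δ) (g : sub Δ Θ) :
  up_sub (σ := σ) f >> up_sub g = up_sub (f >> g).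
Proof.
  apply sub_ext_cons; try reflexivity.
  intros; cbn; unfold wk; now rewrite sub_ren_tm, ren_sub_tm.
Qed.

Lemma sub_sub_tm {Γ σ} (t : tm Γ σ) : forall Δ Θ (f : sub Γ Δ) (g : sub Δ Θ),
  sub_tm g (sub_tm f t) = sub_tm (f >> g) t.
Proof.
  induction t; intros; cbn; try reflexivity; [now rewrite IHt1, IHt2|].
  now rewrite IHt, up_comp.
Qed.

Lemma sub_sub_fm {Γ} (φ : fm Γ) : forall Δ Θ (f : sub Γ Δ) (g : sub Δ Θ),
  sub_fm g (sub_fm f φ) = sub_fm (f >> g) φ.
Proof.
  induction φ; intros; cbn; rewrite ?sub_sub_tm, ?IHφ1, ?IHφ2, ?IHφ, ?up_comp; reflexivity.
Qed.

Lemma up_ids {Γ σ} : up_sub (σ := σ) (@ids Γ) = ids.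
Proof. apply sub_ext_cons; reflexivity. Qed.

Lemma sub_ids_tm {Γ σ} (t : tm Γ σ) : sub_tm ids t = t.
Proof. induction t; cbn; rewrite ?up_ids, ?IHt1, ?IHt2, ?IHt; reflexivity. Qed.

Lemma sub_ids_fm {Γ} (φ : fm Γ) : sub_fm ids φ = φ.
Proof. induction φ; cbn; rewrite ?up_ids, ?sub_ids_tm, ?IHφ1, ?IHφ2, ?IHφ; reflexivity. Qed.

Lemma wk_sub {Γ σ τ} (t : tm Γ τ) : wk (σ := σ) t = sub_tm ↑ t.
Proof. apply ren_tm_sub. Qed.

Lemma wkf_sub {Γ σ} (φ : fm Γ) : wkf (σ := σ) φ = sub_fm ↑ φ.
Proof. apply ren_fm_sub. Qed.

Lemma inst_sub {Γ σ} (φ : fm (σ :: Γ)) u : inst φ u = sub_fm (u .: ids) φ.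
Proof. reflexivity. Qed.

Lemma inst_tm_sub {Γ σ τ} (t : tm (σ :: Γ) τ) u : inst_tm t u = sub_tm (u .: ids) t.
Proof. reflexivity. Qed.

Lemma at_succ_sub {Γ} (φ : fm (ty0 :: Γ)) : at_succ φ = sub_fm (Succ · v0 .: ↑) φ.
Proof. reflexivity. Qed.

Lemma up_sub_scons {Γ Δ σ} (f : sub Γ Δ) : up_sub (σ := σ) f = v0 .: f >> ↑.
Proof. apply sub_ext_cons; try reflexivity; intros; apply wk_sub. Qed.

Lemma ren_sub_shift {Γ σ} : ren_sub (@shift Γ σ) = ↑.
Proof. reflexivity. Qed.

Lemma comp_assoc {Γ Δ Θ Ξ} (f : sub Γ Δ) (g : sub Δ Θ) (h : sub Θ Ξ) :
  f >> g >> h = f >> (g >> h).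
Proof. apply sub_ext; intros; apply sub_sub_tm. Qed.

Lemma ids_comp {Γ Δ} (f : sub Γ Δ) : ids >> f = f.
Proof. apply sub_ext; reflexivity. Qed.

Lemma comp_ids {Γ Δ} (f : sub Γ Δ) : f >> ids = f.
Proof. apply sub_ext; intros; apply sub_ids_tm. Qed.

Lemma shift_scons {Γ Δ σ} (t : tm Δ σ) (f : sub Γ Δ) : ↑ >> (t .: f) = f.
Proof. apply sub_ext; reflexivity. Qed.

Lemma scons_comp {Γ Δ Θ σ} (t : tm Δ σ) (f : sub Γ Δ) (g : sub Δ Θ) :
  (t .: f) >> g = sub_tm g t .: f >> g.
Proof. apply sub_ext_cons; reflexivity. Qed.

(** The case of [shift_scons] that is hidden by associating compositions to the
    right. *)
Lemma shift_scons_assoc {Γ Δ Θ σ} (t : tm Δ σ) (f : sub Γ Δ) (g : sub Δ Θ) :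
  ↑ >> ((t .: f) >> g) = f >> g.
Proof. apply sub_ext; reflexivity. Qed.

Lemma scons_ids {Γ σ} : v0 .: ↑ = @ids (σ :: Γ).
Proof. apply sub_ext_cons; reflexivity. Qed.

Lemma scons_shift {Γ Δ σ} (f : sub (σ :: Γ) Δ) : f _ vz .: (↑ >> f) = f.
Proof. apply sub_ext_cons; reflexivity. Qed.

(** [scons_shift] as a simplification. It is not part of [asimp] below because it
    has to find [t] up to conversion. *)
Ltac eta := repeat match goal with
  | |- context [?t .: (↑ >> ?f)] =>
      change (t .: (↑ >> f)) with (f _ vz .: (↑ >> f)); rewrite scons_shift
  end.

(** Standard functionals are closed terms; kept folded, they are invariant under
    substitution ([sub_cl]). *)
Definition cl {Γ : ctx} {σ : ty} (t : tm [] σ) : tm Γ σ := ren_tm (no_vars Γ) t.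

Lemma sub_cl {Γ Δ σ} (f : sub Γ Δ) (t : tm [] σ) : sub_tm f (cl t) = cl t.
Proof.
  unfold cl; rewrite sub_ren_tm, ren_tm_sub; f_equal.
  apply sub_ext; intros τ x; exact (match x with end).
Qed.

Lemma sub_dflt {Γ Δ} σ : forall f : sub Γ Δ, sub_tm f (dflt σ) = dflt σ.
Proof.
  revert Γ Δ; induction σ; intros; cbn; try reflexivity.
  now rewrite IHσ2.
Qed.

Lemma sub_len {Γ Δ σ} (f : sub Γ Δ) : sub_tm f (len (σ := σ)) = len.
Proof. reflexivity. Qed.

Lemma sub_item {Γ Δ σ} (f : sub Γ Δ) : sub_tm f (item (σ := σ)) = item.
Proof. unfold item; cbn; now rewrite sub_dflt. Qed.

Lemma sub_add {Γ Δ} (f : sub Γ Δ) : sub_tm f add_t = add_t.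
Proof. reflexivity. Qed.

Lemma sub_mem {Γ Δ σ} (f : sub Γ Δ) (q : tm Γ σ) Q :
  sub_fm f (Mem q Q) = Mem (sub_tm f q) (sub_tm f Q).
Proof.
  unfold Mem, Lt, wk; cbn [sub_fm sub_tm ren_tm].
  rewrite ?up_sub_scons, ?ren_tm_sub, ?ren_sub_shift, ?sub_len, ?sub_item, ?sub_add.
  rewrite ?sub_sub_tm, ?comp_assoc, ?scons_comp, ?shift_scons_assoc, ?shift_scons, ?comp_assoc.
  reflexivity.
Qed.

Ltac push := cbn [sub_tm sub_fm map scons comp shift_sub ids ren_sub Neg AllSt ExSt Iff].

(** The context patterns make sure that a rewrite is tried only where its left
    side occurs syntactically. [Mem] and the closed terms stay folded. *)
Ltac asimp :=
  unfold Lt, Iff, AllSt, ExSt, Neg;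
  repeat (push; progress repeat match goal with
  | |- context [inst _ _] => rewrite !inst_sub
  | |- context [inst_tm _ _] => rewrite !inst_tm_sub
  | |- context [at_succ _] => rewrite !at_succ_sub
  | |- context [wk _] => rewrite !wk_sub
  | |- context [wkf _] => rewrite !wkf_sub
  | |- context [ren_tm _ _] => rewrite !ren_tm_sub
  | |- context [ren_fm _ _] => rewrite !ren_fm_sub
  | |- context [ren_sub (up_ren _)] => rewrite !up_ren_sub
  | |- context [ren_sub shift] => rewrite !ren_sub_shift
  | |- context [up_sub _] => rewrite !up_sub_scons
  | |- context [sub_tm _ (sub_tm _ _)] => rewrite !sub_sub_tm
  | |- context [sub_fm _ (sub_fm _ _)] => rewrite !sub_sub_fm
  | |- context [(_ >> _) >> _] => rewrite !comp_assoc
  | |- context [ids >> _] => rewrite !ids_comp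
  | |- context [_ >> ids] => rewrite !comp_ids
  | |- context [↑ >> (_ .: _)] => rewrite !shift_scons
  | |- context [(_ .: _) >> _] => rewrite !scons_comp
  | |- context [↑ >> ((_ .: _) >> _)] => rewrite !shift_scons_assoc
  | |- context [v0 .: ↑] => rewrite !scons_ids
  | |- context [sub_tm ids _] => rewrite !sub_ids_tm
  | |- context [sub_fm ids _] => rewrite !sub_ids_fm
  | |- context [sub_tm _ (cl _)] => rewrite !sub_cl
  | |- context [sub_tm _ (dflt _)] => rewrite !sub_dflt
  | |- context [sub_tm _ len] => rewrite !sub_len
  | |- context [sub_tm _ item] => rewrite !sub_item
  | |- context [sub_tm _ add_t] => rewrite !sub_add
  | |- context [sub_fm _ (Mem _ _)] => rewrite !sub_mem
  end); push.

(** * Derived rules of the natural deduction *)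

Lemma prv_weaken {Γ} (H : list (fm Γ)) φ :
  prv H φ -> forall H', incl H H' -> prv H' φ.
Proof.
  assert (push : forall (Δ : ctx) (K K' : list (fm Δ)) ψ, incl K K' -> incl (ψ :: K) (ψ :: K')).
  { intros Δ K K' ψ i x [<- | j]; [now left | right; auto]. }
  induction 1; intros H' i; solve [econstructor; eauto using incl_map].
Qed.

Lemma prv_nil {Γ} (H : list (fm Γ)) φ : prv [] φ -> prv H φ.
Proof. intro p; apply (prv_weaken p); intros ? []. Qed.

Lemma prv_cut {Γ} (H : list (fm Γ)) φ ψ : prv H φ -> prv (φ :: H) ψ -> prv H ψ.
Proof. intros p q; exact (prv_impE (prv_impI q) p). Qed.

Lemma prv_bot {Γ} (H : list (fm Γ)) φ : prv H Bot -> prv H φ.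
Proof. intro p; apply prv_raa, (prv_weaken p), incl_tl, incl_refl. Qed.

Lemma prv_negE {Γ} (H : list (fm Γ)) φ ψ : prv H (Neg φ) -> prv H φ -> prv H ψ.
Proof. intros p q; exact (prv_bot _ (prv_impE p q)). Qed.

Lemma prv_allE' {Γ} (H : list (fm Γ)) σ (φ : fm (σ :: Γ)) t χ :
  prv H (All σ φ) -> inst φ t = χ -> prv H χ.
Proof. intros p <-; now apply prv_allE. Qed.

Lemma prv_allStE {Γ} (H : list (fm Γ)) σ (φ : fm (σ :: Γ)) t χ :
  prv H (AllSt σ φ) -> prv H (St t) -> inst φ t = χ -> prv H χ.
Proof. intros p q <-; exact (prv_impE (prv_allE t p) q). Qed.

Lemma prv_allStI {Γ} (H : list (fm Γ)) σ (φ : fm (σ :: Γ)) :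
  prv (St v0 :: map wkf H) φ -> prv H (AllSt σ φ).
Proof. intro p; now apply prv_allI, prv_impI. Qed.

Lemma prv_exStI {Γ} (H : list (fm Γ)) σ (φ : fm (σ :: Γ)) t :
  prv H (St t) -> prv H (inst φ t) -> prv H (ExSt σ φ).
Proof. intros p q; exact (prv_exI (φ := And (St v0) φ) (t := t) (prv_andI p q)). Qed.

Lemma prv_exStE {Γ} (H : list (fm Γ)) σ (φ : fm (σ :: Γ)) χ :
  prv H (ExSt σ φ) -> prv (φ :: St v0 :: map wkf H) (wkf χ) -> prv H χ.
Proof.
  intros p q; apply (prv_exE p).
  apply prv_cut with (φ := St v0); [eapply prv_andE1, prv_hyp, in_eq|].
  apply prv_cut with (φ := φ); [eapply prv_andE2, prv_hyp, in_cons, in_eq|].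
  apply (prv_weaken q); intros x [<- | [<- | i]]; cbn; auto.
Qed.

(** [hypn n] uses hypothesis number [n], counted from the most recent one;
    [spec n t] instantiates the universal hypothesis number [n] with [t] and adds
    the result as hypothesis [0]. *)
Ltac hyp := apply prv_hyp; push; repeat (first [left; reflexivity | right]).
Tactic Notation "hypn" int_or_var(n) := apply prv_hyp; push; do n right; left; reflexivity.
Tactic Notation "spec" int_or_var(n) uconstr(t) :=
  refine (prv_cut (prv_allE t _) _); [hypn n | asimp].

Lemma prv_iff1 {Γ} (H : list (fm Γ)) φ ψ : prv [] (Iff φ ψ) -> prv H φ -> prv H ψ.
Proof. intros p; apply prv_impE, prv_nil, (prv_andE1 p). Qed.

Lemma prv_iff2 {Γ} (H : list (fm Γ)) φ ψ : prv [] (Iff φ ψ) -> prv H ψ -> prv H φ.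
Proof. intros p; apply prv_impE, prv_nil, (prv_andE2 p). Qed.
Lemma iff_neg {Γ} (φ ψ : fm Γ) : prv [] (Iff φ ψ) -> prv [] (Iff (Neg φ) (Neg ψ)).
Proof.
  intro e; apply prv_andI; apply prv_impI, prv_impI.
  - eapply prv_negE; [hypn 1 | apply (prv_iff2 e); hyp].
  - eapply prv_negE; [hypn 1 | apply (prv_iff1 e); hyp].
Qed.

Lemma iff_or {Γ} (φ φ' ψ ψ' : fm Γ) : prv [] (Iff φ φ') -> prv [] (Iff ψ ψ') ->
  prv [] (Iff (Or φ ψ) (Or φ' ψ')).
Proof.
  intros e f; apply prv_andI; apply prv_impI; (eapply prv_orE; [hyp | |]).
  - apply prv_orI1, (prv_iff1 e); hyp.
  - apply prv_orI2, (prv_iff1 f); hyp.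
  - apply prv_orI1, (prv_iff2 e); hyp.
  - apply prv_orI2, (prv_iff2 f); hyp.
Qed.

Lemma iff_all {Γ} σ (φ ψ : fm (σ :: Γ)) : prv [] (Iff φ ψ) ->
  prv [] (Iff (All σ φ) (All σ ψ)).
Proof.
  intro e; apply prv_andI; apply prv_impI, prv_allI; asimp.
  - apply (prv_iff1 e); eapply prv_allE' with (t := v0); [hyp | now asimp].
  - apply (prv_iff2 e); eapply prv_allE' with (t := v0); [hyp | now asimp].
Qed.


(** * Equational reasoning *)

Definition teq {Γ} (H : list (fm Γ)) {σ} (s t : tm Γ σ) : Prop := prv H (Eq s t).

Lemma prv_refl {Γ} (H : list (fm Γ)) σ (t : tm Γ σ) : prv H (Eq t t).
Proof. apply prv_axiom, ax_EPA, ax_refl. Qed.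

Lemma internal_sub {Γ} (φ : fm Γ) : forall Δ (f : sub Γ Δ),
  internal φ -> internal (sub_fm f φ).
Proof. induction φ; cbn; intuition. Qed.

Lemma prv_leibniz {Γ} (H : list (fm Γ)) σ (φ : fm (σ :: Γ)) s t :
  internal φ -> teq H s t -> prv H (inst φ s) -> prv H (inst φ t).
Proof.
  intros i p q; refine (prv_impE (prv_impE _ p) q).
  now apply prv_axiom, ax_EPA, ax_subst.
Qed.

Lemma teq_app1 {Γ} (H : list (fm Γ)) σ τ (f g : tm Γ (σ ⇒ τ)) t :
  teq H f g -> teq H (f · t) (g · t).
Proof.
  intro p.
  pose proof (@prv_leibniz Γ H _ (Eq (wk (f · t)) (v0 · wk t)) f g I p) as q.
  revert q; asimp; intro q; apply q; apply prv_refl.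
Qed.

Lemma teq_app2 {Γ} (H : list (fm Γ)) σ τ (f : tm Γ (σ ⇒ τ)) s t :
  teq H s t -> teq H (f · s) (f · t).
Proof.
  intro p.
  pose proof (@prv_leibniz Γ H _ (Eq (wk (f · s)) (wk f · v0)) s t I p) as q.
  revert q; asimp; intro q; apply q; apply prv_refl.
Qed.

#[global] Instance teq_equiv {Γ} (H : list (fm Γ)) σ : Equivalence (@teq Γ H σ).
Proof.
  assert (sym : Symmetric (@teq Γ H σ)).
  { intros s t p.
    pose proof (@prv_leibniz Γ H _ (Eq v0 (wk s)) s t I p) as q.
    revert q; asimp; intro q; apply q; apply prv_refl. }
  split; try assumption.
  - intro t; apply prv_refl.
  - intros s t u p p'.
    pose proof (@prv_leibniz Γ H _ (Eq v0 (wk u)) t s I (sym _ _ p)) as q.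
    revert q; asimp; intro q; now apply q.
Qed.

#[global] Instance teq_app {Γ} (H : list (fm Γ)) σ τ :
  Proper (teq H ==> teq H ==> teq H) (@App Γ σ τ).
Proof.
  intros f g p s t q; transitivity (f · t); [now apply teq_app2 | now apply teq_app1].
Qed.

(** Leibniz's law for a formula under a substitution, at the first variable
    here and at the second one in [prv_replace1]. *)
Lemma prv_replace {Γ Δ} (H : list (fm Γ)) σ (φ : fm (σ :: Δ)) (f : sub Δ Γ) s t :
  internal φ -> teq H s t -> prv H (sub_fm (s .: f) φ) -> prv H (sub_fm (t .: f) φ).
Proof.
  intros i p.
  pose proof (@prv_leibniz Γ H σ (sub_fm (v0 .: f >> ↑) φ) s t (internal_sub _ i) p) as q.
  revert q; now asimp.
Qed.

Lemma prv_replace_v0 {Γ} σ (H : list (fm (σ :: Γ))) (φ : fm (σ :: Γ)) s :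
  internal φ -> teq H v0 s -> prv H (sub_fm (s .: ↑) φ) -> prv H φ.
Proof.
  intros i p q; rewrite <- (sub_ids_fm φ), <- scons_ids.
  apply prv_replace with (s := s); [assumption | now symmetry | assumption].
Qed.


Lemma prv_replace1 {Γ Δ} (H : list (fm Γ)) σ τ (φ : fm (τ :: σ :: Δ)) (f : sub (σ :: Δ) Γ) s t :
  internal φ -> teq H s (f _ vz) ->
  prv H (sub_fm (t .: s .: ↑ >> f) φ) -> prv H (sub_fm (t .: f) φ).
Proof.
  intros i p.
  pose proof (@prv_leibniz Γ H σ (sub_fm (wk t .: v0 .: ↑ >> f >> ↑) φ) s _
    (internal_sub _ i) p) as q.
  revert q; asimp; rewrite scons_shift; auto.
Qed.

Lemma beta {Γ} (H : list (fm Γ)) σ τ (t : tm (σ :: Γ) τ) u :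
  teq H (Lam t · u) (inst_tm t u).
Proof. apply prv_axiom, ax_EPA, ax_beta. Qed.

Lemma rec_zero {Γ} (H : list (fm Γ)) ρ (y : tm Γ ρ) z : teq H (Rec · Zero · y · z) y.
Proof. apply prv_axiom, ax_EPA, ax_rec_zero. Qed.

Lemma rec_succ {Γ} (H : list (fm Γ)) ρ n (y : tm Γ ρ) z :
  teq H (Rec · (Succ · n) · y · z) (z · (Rec · n · y · z) · n).
Proof. apply prv_axiom, ax_EPA, ax_rec_succ. Qed.

Lemma lrec_nil {Γ} (H : list (fm Γ)) σ ρ (y : tm Γ ρ) (z : tm Γ (ρ ⇒ σ ⇒ ρ)) :
  teq H (LRec · Nil · y · z) y.
Proof. apply prv_axiom, ax_EPA, ax_lrec_nil. Qed.

Lemma lrec_cons {Γ} (H : list (fm Γ)) σ ρ a Q (y : tm Γ ρ) (z : tm Γ (ρ ⇒ σ ⇒ ρ)) :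
  teq H (LRec · (Cons · a · Q) · y · z) (z · (LRec · Q · y · z) · a).
Proof. apply prv_axiom, ax_EPA, ax_lrec_cons. Qed.

Lemma teq_ext {Γ} (H : list (fm Γ)) σ τ (f g : tm Γ (σ ⇒ τ)) :
  teq (map wkf H) (wk f · v0) (wk g · v0) -> teq H f g.
Proof.
  intro p; refine (prv_impE _ (prv_allI p)); apply prv_axiom, ax_EPA, ax_ext.
Qed.

(** The hypotheses are hidden, since a redex inside them would be found first
    and cannot be rewritten. *)
Ltac calc :=
  let K := fresh in
  match goal with |- @teq _ ?H _ _ _ => set (K := H) end;
  repeat (first [rewrite beta | rewrite rec_zero | rewrite rec_succ
    | rewrite lrec_nil | rewrite lrec_cons]; asimp);
  subst K.

Lemma add_zero {Γ} (H : list (fm Γ)) n : teq H (add_t · n · Zero) n.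
Proof. unfold add_t; calc; reflexivity. Qed.

Lemma add_succ {Γ} (H : list (fm Γ)) n m :
  teq H (add_t · n · (Succ · m)) (Succ · (add_t · n · m)).
Proof. unfold add_t; calc; reflexivity. Qed.

Lemma len_nil {Γ} (H : list (fm Γ)) σ : teq H (len · Nil (σ := σ)) Zero.
Proof. unfold len; calc; reflexivity. Qed.

Lemma len_cons {Γ} (H : list (fm Γ)) σ (a : tm Γ σ) Q :
  teq H (len · (Cons · a · Q)) (Succ · (len · Q)).
Proof. unfold len; calc; reflexivity. Qed.

(** * Induction on numbers and on sequences *)

Lemma succ_neq_zero {Γ} (H : list (fm Γ)) t φ : teq H (Succ · t) Zero -> prv H φ.
Proof. apply prv_negE, prv_axiom, ax_EPA, ax_succ_nonzero. Qed.

Lemma succ_inj {Γ} (H : list (fm Γ)) s t : teq H (Succ · s) (Succ · t) -> teq H s t.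
Proof. apply prv_impE, prv_axiom, ax_EPA, ax_succ_inj. Qed.

Lemma prv_ind {Γ} (H : list (fm Γ)) (φ : fm (ty0 :: Γ)) :
  internal φ -> prv H (inst φ Zero) -> prv (φ :: map wkf H) (at_succ φ) ->
  prv H (All ty0 φ).
Proof.
  intros i z s; refine (prv_impE _ (prv_andI z (prv_allI (prv_impI s)))).
  now apply prv_axiom, ax_EPA, ax_induction.
Qed.

Lemma zero_or_succ {Γ} (H : list (fm Γ)) t :
  prv H (Or (Eq t Zero) (Ex ty0 (Eq (wk t) (Succ · v0)))).
Proof.
  apply prv_allE' with (φ := Or (Eq v0 Zero) (Ex ty0 (Eq v1 (Succ · v0)))) (t := t).
  - apply prv_ind; [cbn; tauto | |]; asimp.
    + apply prv_orI1, prv_refl.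
    + apply prv_orI2, prv_exI with (t := v0); asimp. apply prv_refl.
  - now asimp.
Qed.

(** The axioms have induction for numbers only, so the induction is on the
    length, for all sequences simultaneously. The step is a formula rather than a
    derivation, so that it can be used below the quantifiers over the length and
    the sequence. *)
Lemma prv_seq_ind {Γ} (H : list (fm Γ)) σ (φ : fm (Seq σ :: Γ)) t :
  internal φ -> prv H (inst φ Nil) ->
  prv H (All σ (All (Seq σ)
    (Imp (sub_fm (v0 .: ↑ >> ↑) φ) (sub_fm (Cons · v1 · v0 .: ↑ >> ↑) φ)))) ->
  prv H (inst φ t).
Proof.
  intros i z s; apply (prv_cut z), (prv_cut (prv_weaken s (incl_tl _ (incl_refl H)))).
  clear z s.
  apply prv_cut with (φ := All ty0 (All (Seq σ)
    (Imp (Eq (len · v0) v1) (sub_fm (v0 .: ↑ >> ↑) φ)))).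
  - apply prv_ind; [split; [exact I | now apply internal_sub] | |]; asimp;
      apply prv_allI, prv_impI; asimp;
      (eapply prv_orE; [apply prv_axiom, ax_EPA, ax_seq with (Q := v0) | |]).
    asimp.
    + apply prv_replace_v0 with (s := Nil); [assumption | hyp | hyp].
    + eapply prv_exE; [hyp|]; eapply prv_exE; [hyp|]; asimp.
      apply succ_neq_zero with (t := len (σ := σ) · v0).
      rewrite <- len_cons with (a := v1). etransitivity; [apply teq_app2; symmetry; hypn 0 | hypn 3].
    + apply prv_replace with (s := Nil); [assumption | symmetry; hyp | hyp].
    + eapply prv_exE; [hyp|]; eapply prv_exE; [hyp|]; asimp.
      apply prv_replace with (s := Cons · v1 · v0); [assumption | symmetry; hyp |].
      spec 5 v1. spec 0 v0. spec 6 v0.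
      refine (prv_impE _ _); [hypn 1|].
      refine (prv_impE _ _); [hypn 0|]. apply succ_inj.
      rewrite <- len_cons with (a := v1). etransitivity; [apply teq_app2; symmetry; hypn 3 | hypn 6].
  - spec 0 (len · t). spec 0 t. refine (prv_impE _ _); [hypn 0|].
    apply prv_refl.
Qed.


(** * Pairs *)

(** The retraction is required in every context and under every list of
    hypotheses, which saves substituting into derivations. *)
Definition retract (σ ρ : ty) : Prop :=
  exists (i : tm [] (σ ⇒ ρ)) (r : tm [] (ρ ⇒ σ)),
    forall Γ (H : list (fm Γ)) t, teq H (cl r · (cl i · t)) t.

Lemma cl_sub {Γ σ} (t : tm [] σ) : cl (Γ := Γ) t = sub_tm (ren_sub (no_vars Γ)) t.
Proof. apply ren_tm_sub. Qed.

Lemma cl_lam {Γ σ τ} (t : tm [σ] τ) :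
  cl (Γ := Γ) (Lam t) = Lam (sub_tm (v0 .: ren_sub (no_vars _)) t).
Proof.
  rewrite cl_sub; cbn; rewrite up_sub_scons; do 2 f_equal.
  apply sub_ext_cons; [reflexivity | intros ? x; exact (match x with end)].
Qed.

Ltac clsimp := rewrite !cl_lam; asimp.

Lemma retract_refl σ : retract σ σ.
Proof.
  exists (Lam v0), (Lam v0); intros; clsimp; calc; reflexivity.
Qed.

Lemma retract_trans ρ σ τ : retract ρ σ -> retract σ τ -> retract ρ τ.
Proof.
  intros (i & r & e) (i' & r' & e').
  exists (Lam (cl i' · (cl i · v0))), (Lam (cl r · (cl r' · v0))).
  intros; clsimp; calc; now rewrite e', e.
Qed.

Lemma retract_const σ τ : retract τ (σ ⇒ τ).
Proof.
  exists (Lam (Lam v1)), (Lam (v0 · dflt σ)); intros; clsimp; calc; reflexivity.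
Qed.

Lemma retract_arr σ τ ρ : retract τ ρ -> retract (σ ⇒ τ) (σ ⇒ ρ).
Proof.
  intros (i & r & e).
  exists (Lam (Lam (cl i · (v1 · v0)))), (Lam (Lam (cl r · (v1 · v0)))).
  intros; apply teq_ext; clsimp; calc; apply e.
Qed.

(** A number is coded by a sequence of that length. *)
Lemma retract_zero_seq σ : retract ty0 (Seq σ).
Proof.
  exists (Lam (Rec · v0 · Nil · Lam (Lam (Cons · dflt σ · v1)))), len.
  intros; rewrite (cl_sub len); clsimp.
  pose (φ := Eq (len · (Lam (Rec · v0 · Nil · Lam (Lam (Cons · dflt σ · v1))) · v0)) v0 : fm (ty0 :: Γ)).
  apply prv_allE' with (φ := φ) (t := t); [|now unfold φ; asimp].
  apply prv_ind; [exact I | |]; unfold φ; asimp; apply (@id (teq _ _ _)); calc.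
  - apply len_nil.
  - rewrite len_cons; apply teq_app2. etransitivity; [|hyp].
    apply teq_app2; symmetry; calc; reflexivity.
Qed.

(** The elementwise image of a sequence. *)
Definition smap {Γ σ τ} (f : tm Γ (σ ⇒ τ)) : tm Γ (Seq σ ⇒ Seq τ) :=
  Lam (LRec · v0 · Nil · Lam (Lam (Cons · (wk (wk (wk f)) · v0) · v1))).

Lemma smap_nil {Γ} (H : list (fm Γ)) σ τ (f : tm Γ (σ ⇒ τ)) :
  teq H (smap f · Nil) Nil.
Proof. unfold smap; calc; reflexivity. Qed.

Lemma smap_cons {Γ} (H : list (fm Γ)) σ τ (f : tm Γ (σ ⇒ τ)) a Q :
  teq H (smap f · (Cons · a · Q)) (Cons · (f · a) · (smap f · Q)).
Proof. unfold smap; calc; reflexivity. Qed.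

Lemma sub_smap {Γ Δ} σ τ (f : tm Γ (σ ⇒ τ)) (g : sub Γ Δ) :
  sub_tm g (smap f) = smap (sub_tm g f).
Proof. unfold smap; now asimp. Qed.

Lemma retract_seq σ τ : retract σ τ -> retract (Seq σ) (Seq τ).
Proof.
  intros (i & r & e).
  exists (smap i), (smap r); intros.
  rewrite !cl_sub, !sub_smap, <- !cl_sub.
  pose (φ := Eq (smap (cl r) · (smap (cl i) · v0)) v0 : fm (Seq σ :: Γ)).
  assert (p : prv H (inst φ t)).
  - apply prv_seq_ind; [exact I | |]; unfold φ; asimp; rewrite ?sub_smap; asimp.
    + apply (@id (teq _ _ _)); now rewrite !smap_nil.
    + apply prv_allI, prv_allI, prv_impI; asimp; apply (@id (teq _ _ _)).
      rewrite !smap_cons, e. apply teq_app2; hyp.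
  - unfold φ in p; revert p; asimp; rewrite ?sub_smap; now asimp.
Qed.

(** Every type has [0] or a sequence type as its final target. *)
Lemma retract_zero τ : retract ty0 τ.
Proof.
  induction τ.
  - apply retract_refl.
  - exact (retract_trans IHτ2 (retract_const _ _)).
  - apply retract_zero_seq.
Qed.

(** A function type is handled by joining its target, and two sequence types
    elementwise; the remaining cases have type [0] on one side. *)
Lemma retract_join σ : forall τ, exists ρ, retract σ ρ /\ retract τ ρ.
Proof.
  induction σ as [|a _ b IH|a IH].
  - intro τ; exists τ; split; [apply retract_zero | apply retract_refl].
  - intro τ; destruct (IH τ) as (ρ & p & q); exists (a ⇒ ρ); split.
    + now apply retract_arr.
    + exact (retract_trans q (retract_const _ _)).
  - induction τ as [|c _ d IHd|c _].
    + exists (Seq a); split; [apply retract_refl | apply retract_zero].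
    + destruct IHd as (ρ & p & q); exists (c ⇒ ρ); split.
      * exact (retract_trans p (retract_const _ _)).
      * now apply retract_arr.
    + destruct (IH c) as (ρ & p & q); exists (Seq ρ); split; now apply retract_seq.
Qed.

Lemma pairing σ τ : exists π (pr : tm [] (σ ⇒ τ ⇒ π)) (p : tm [] (π ⇒ σ)) (q : tm [] (π ⇒ τ)),
  forall Γ (H : list (fm Γ)) s t,
    teq H (cl p · (cl pr · s · t)) s /\ teq H (cl q · (cl pr · s · t)) t.
Proof.
  destruct (retract_join σ τ) as (ρ & (i & r & e) & (i' & r' & e')).
  exists (ty0 ⇒ ρ), (Lam (Lam (Lam (Rec · v0 · (cl i · v2) · Lam (Lam (cl i' · v3)))))),
    (Lam (cl r · (v0 · Zero))), (Lam (cl r' · (v0 · one))).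
  intros; clsimp; unfold one; split; calc; [apply e | apply e'].
Qed.

(** * Standard objects *)

Lemma st_cl {Γ} (H : list (fm Γ)) σ (t : tm [] σ) : prv H (St (cl t)).
Proof. apply prv_axiom, ax_st_closed. Qed.

Lemma st_app {Γ} (H : list (fm Γ)) σ τ (f : tm Γ (σ ⇒ τ)) t :
  prv H (St f) -> prv H (St t) -> prv H (St (f · t)).
Proof.
  intros p q; refine (prv_impE _ (prv_andI p q)); apply prv_axiom, ax_st_app.
Qed.

Lemma st_eq {Γ} (H : list (fm Γ)) σ (s t : tm Γ σ) :
  prv H (St s) -> teq H s t -> prv H (St t).
Proof.
  intros p q; refine (prv_impE _ (prv_andI p q)); apply prv_axiom, ax_st_eq.
Qed.

Lemma st_zero {Γ} (H : list (fm Γ)) : prv H (St Zero).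
Proof. exact (st_cl H Zero). Qed.

Lemma st_succ {Γ} (H : list (fm Γ)) n : prv H (St n) -> prv H (St (Succ · n)).
Proof. apply st_app; exact (st_cl H Succ). Qed.

(** External induction on [n], simultaneously for all [i] and [k] with
    [i + k = n]: either [k = 0] and [i] is [n] itself, or [k] is a successor and
    the hypothesis for the predecessor of [n] applies. *)
Lemma st_below {Γ} (H : list (fm Γ)) i k n :
  prv H (St n) -> teq H (add_t · i · k) n -> prv H (St i).
Proof.
  intros p q.
  pose (φ := All ty0 (All ty0 (Imp (Eq (add_t · v1 · v0) v2) (St v1))) : fm (ty0 :: Γ)).
  assert (r : prv H (AllSt ty0 φ)).
  - refine (prv_impE _ (prv_andI _ _)); [apply prv_axiom, ax_external_induction | |];
      unfold φ; asimp.
    + apply prv_allI, prv_allI, prv_impI; asimp.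
      eapply prv_orE; [apply zero_or_succ with (t := v0) | |]; asimp.
      * apply st_eq with (s := Zero); [apply st_zero|].
        symmetry; etransitivity; [symmetry; apply add_zero|].
        etransitivity; [apply teq_app2; symmetry; hypn 0 | hypn 1].
      * eapply prv_exE; [hyp|]; asimp.
        apply succ_neq_zero with (t := add_t · v2 · v0).
        etransitivity; [symmetry; apply add_succ|].
        etransitivity; [apply teq_app2; symmetry; hypn 0 | hypn 2].
    + apply prv_allI, prv_impI, prv_impI, prv_allI, prv_allI, prv_impI; asimp.
      eapply prv_orE; [apply zero_or_succ with (t := v0) | |]; asimp.
      * apply st_eq with (s := Succ · v2); [apply st_succ; hyp |].
        symmetry; etransitivity; [symmetry; apply add_zero|].
        etransitivity; [apply teq_app2; symmetry; hypn 0 | hypn 1].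
      * eapply prv_exE; [hyp|]; asimp.
        spec 3 v2. spec 0 v0. refine (prv_impE _ _); [hypn 0|].
        apply succ_inj; etransitivity; [symmetry; apply add_succ|].
        etransitivity; [apply teq_app2; symmetry; hypn 2 | hypn 4].
  - assert (r' : prv H (inst φ n)) by (eapply prv_allStE; [exact r | exact p | reflexivity]).
    unfold φ in r'; revert r'; asimp; intro r'.
    apply (prv_cut r'). spec 0 i. spec 0 k. refine (prv_impE _ _); [hypn 0|].
    apply (prv_weaken q); do 3 apply incl_tl; apply incl_refl.
Qed.

(** The element is [Q(i)] for some [i] below the standard number [|Q|], hence
    the value of a standard functional at standard arguments. *)
Lemma st_mem {Γ} (H : list (fm Γ)) σ (Q : tm Γ (Seq σ)) q :
  prv H (St Q) -> prv H (Mem q Q) -> prv H (St q).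
Proof.
  intros p m; apply (prv_cut p).
  eapply prv_exE; [apply (prv_weaken m), incl_tl, incl_refl|]; unfold Mem; asimp.
  eapply st_eq; [|eapply prv_andE2; hyp].
  apply st_app; [apply st_app; [|hyp]|].
  - rewrite <- (@sub_item [] _ σ (ren_sub (no_vars _))), <- cl_sub; apply st_cl.
  - eapply prv_exE; [eapply prv_andE1; hyp|]; asimp.
    apply st_below with (k := Succ · v0) (n := len · sub_tm (↑ >> ↑) Q); [|hyp].
    apply st_app; [|hyp].
    rewrite <- (@sub_len [] _ σ (ren_sub (no_vars _))), <- cl_sub; apply st_cl.
Qed.

(** * Free variables under substitution *)

Lemma occurs_ren {Γ σ} (t : tm Γ σ) : forall Δ (r : ren Γ Δ) m, occurs m (ren_tm r t) ->
  exists τ (x : var Γ τ), occurs (idx x) t /\ idx (r τ x) = m.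
Proof.
  induction t; intros Δ r m h; cbn in *; try contradiction.
  - eauto.
  - destruct h as [h | h]; [apply IHt1 in h | apply IHt2 in h];
      destruct h as (? & x & ? & ?); eauto.
  - apply IHt in h; destruct h as (ρ & x & h & e); revert h e.
    revert ρ x; var_cases.
    intros ρ x h e; injection e; eauto.
Qed.

Lemma occurs_wk {Γ σ τ} (t : tm Γ τ) m : occurs (S m) (wk (σ := σ) t) -> occurs m t.
Proof.
  intro h; apply occurs_ren in h; destruct h as (? & x & h & e).
  now injection e as <-.
Qed.

Lemma occurs_cl {Γ σ} (t : tm [] σ) m : ~ occurs m (cl (Γ := Γ) t).
Proof. intro h; apply occurs_ren in h; destruct h as (? & x & _); exact (match x with end). Qed.

Lemma occurs_dflt {Γ} σ m : ~ occurs m (dflt (Γ := Γ) σ).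
Proof. revert Γ m; induction σ; cbn; auto. Qed.

(** The predicate [P] is occurrence in a term or in a formula. *)
Lemma occurs_up_sub {Γ Δ σ} (P : nat -> Prop) (f : sub Γ Δ) m :
  (exists τ (x : var (σ :: Γ) τ), P (idx x) /\ occurs (S m) (up_sub f x)) ->
  exists τ (x : var Γ τ), P (S (idx x)) /\ occurs m (f τ x).
Proof.
  intros (ρ & x & h & e); revert h e; revert ρ x.
  var_cases.
  intros ρ x h e; apply occurs_wk in e; eauto.
Qed.

Lemma occurs_sub {Γ σ} (t : tm Γ σ) : forall Δ (f : sub Γ Δ) m, occurs m (sub_tm f t) ->
  exists τ (x : var Γ τ), occurs (idx x) t /\ occurs m (f τ x).
Proof.
  induction t; intros Δ f m h; cbn in *; try contradiction.
  - eauto.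
  - destruct h as [h | h]; [apply IHt1 in h | apply IHt2 in h];
      destruct h as (? & x & ? & ?); eauto.
  - apply IHt in h; exact (occurs_up_sub (P := fun n => occurs n t) h).
Qed.

Lemma free_sub {Γ} (φ : fm Γ) : forall Δ (f : sub Γ Δ) m, free m (sub_fm f φ) ->
  exists τ (x : var Γ τ), free (idx x) φ /\ occurs m (f τ x).
Proof.
  induction φ; intros Δ f m h; cbn in *; try contradiction;
    try (destruct h as [h | h]);
    first [ apply occurs_sub in h | apply IHφ1 in h | apply IHφ2 in h
          | apply IHφ in h; apply occurs_up_sub with (P := fun n => free n φ) in h ];
    destruct h as (? & ? & ? & ?); eauto 6.
Qed.

Lemma free_mem {Γ} σ (q : tm Γ σ) Q n : free n (Mem q Q) -> occurs n q \/ occurs n Q.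
Proof.
  cbn; unfold wk; intros [[[h | h] | h] | h]; cbn in h; intuition; try discriminate;
  repeat match goal with
  | h : occurs _ (dflt _) |- _ => now apply occurs_dflt in h
  | h : occurs (S _) (ren_tm shift _) |- _ => apply occurs_wk in h
  end; auto.
Qed.

Lemma free_nf {Γ ρ τ} (ψ : fm (τ :: ρ :: Γ)) n :
  free n (AllSt ρ (ExSt τ ψ)) -> free (S (S n)) ψ.
Proof. cbn; intuition; discriminate. Qed.

(** * Normal forms *)

(** Two variables suffice, because tuples can be coded by pairs; keeping exactly
    one of each kind lets choice and idealisation be applied as they stand. The
    free variables of [ψ] are shifted by the two bound ones. *)
Definition has_nf {Γ} (φ : fm Γ) : Prop :=
  exists ρ τ (ψ : fm (τ :: ρ :: Γ)), internal ψ
    /\ (forall n, free (S (S n)) ψ -> free n φ)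
    /\ prv [] (Iff φ (AllSt ρ (ExSt τ ψ))).

Lemma has_nf_iff {Γ} (φ φ' : fm Γ) :
  prv [] (Iff φ φ') -> (forall n, free n φ' -> free n φ) -> has_nf φ' -> has_nf φ.
Proof.
  intros e f (ρ & τ & ψ & i & g & e'); exists ρ, τ, ψ; split; [assumption | split; auto].
  apply prv_andI; apply prv_impI.
  - apply (prv_iff1 e'), (prv_iff1 e); hyp.
  - apply (prv_iff2 e), (prv_iff2 e'); hyp.
Qed.

(** Both quantifiers are vacuous, over type [0]. *)
Lemma has_nf_internal {Γ} (φ : fm Γ) : internal φ -> has_nf φ.
Proof.
  intro i; exists ty0, ty0, (sub_fm (↑ >> ↑) φ); split; [now apply internal_sub | split].
  - intros n h; apply free_sub in h; destruct h as (τ & x & h & e); cbn in e.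
    now injection e as <-.
  - asimp; apply prv_andI; apply prv_impI.
    + apply prv_allStI, prv_exStI with (t := Zero); [apply st_zero | asimp; hyp].
    + apply prv_exStE with (σ := ty0) (φ := sub_fm ↑ φ); [|asimp; hyp].
      eapply prv_allStE with (t := Zero); [hyp | apply st_zero | now asimp].
Qed.

(** [St t] says that [t] equals some standard object. *)
Lemma has_nf_st {Γ} σ (t : tm Γ σ) : has_nf (St t).
Proof.
  exists ty0, σ, (Eq v0 (wk (wk t))); split; [exact I | split].
  - intros n [h | h]; [discriminate h | now do 2 apply occurs_wk in h].
  - asimp; apply prv_andI; apply prv_impI.
    + apply prv_allStI, prv_exStI with (t := wk t); asimp; [hyp | apply prv_refl].
    + apply prv_exStE with (φ := Eq v0 (wk t)).
      * eapply prv_allStE with (t := Zero); [hyp | apply st_zero | now asimp].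
      * asimp; apply st_eq with (s := v0); hyp.
Qed.

(** Choice for [ψ] gives the implication from the new form to the negation. In the
    other direction, if [F] were a standard choice function for [∃y ∈ F(x) ψ], then
    every such [y] would be standard, as [F(x)] is. *)
Lemma has_nf_neg {Γ} (φ : fm Γ) : has_nf φ -> has_nf (Neg φ).
Proof.
  intros (ρ & τ & ψ & i & g & e); apply (has_nf_iff (iff_neg e)).
  { intros n [h | []]; left; now apply g, free_nf. }
  pose (χ := sub_fm (v0 .: v1 .: ↑ >> (↑ >> ↑)) ψ : fm (τ :: ρ :: (ρ ⇒ Seq τ) :: Γ)).
  exists (ρ ⇒ Seq τ), ρ, (Neg (Ex τ (And (Mem v0 (v2 · v1)) χ))); split; [|split].
  - cbn; repeat split; now apply internal_sub.
  - intros n [[h | h] | []].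
    + apply free_mem in h; cbn in h; intuition; discriminate.
    + apply free_sub in h; destruct h as (τ' & x & h & f); revert h f; revert τ' x.
      var_cases. intros τ' x h f; injection f as <-. left; right; now right.
  - apply prv_andI; apply prv_impI; unfold χ.
    + apply prv_allStI, prv_raa; asimp.
      eapply prv_negE; [hypn 2|]; asimp. apply prv_allStI, prv_raa; asimp.
      eapply prv_negE; [hypn 2|].
      apply prv_exStI with (t := v0); [hyp|]; asimp; apply prv_impI.
      eapply prv_exE; [hyp|]; asimp.
      eapply prv_negE; [hypn 2|].
      apply prv_exStI with (t := v0); asimp; [|eapply prv_andE2; hyp].
      apply st_mem with (Q := v2 · v1); [|asimp; eapply prv_andE1; hyp].
      apply st_app; hyp.
    + apply prv_impI.
      (* The choice function, to which the new form is then applied. *)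
      eapply prv_exStE;
        [eapply prv_impE; [apply prv_axiom, ax_HAC_int with (ρ := ρ) (τ := τ), i | hypn 0] |].
      asimp. spec 3 v0. refine (prv_cut (prv_impE _ _) _); [hypn 0 | hypn 2 |].
      eapply prv_exE; [hypn 0|]; asimp.
      eapply prv_negE; [eapply prv_andE2; hypn 0|].
      spec 3 v0. refine (prv_impE _ _); [hypn 0 | eapply prv_andE1; hypn 1].
Qed.

(** If no standard sequence [s] satisfies [∀z ∃y ∈ s ψ], then idealisation applied
    to the negation of [ψ] yields one [z] such that [ψ] fails for all standard [y].
    In the other direction, the elements of a standard [s] are standard. *)
Lemma has_nf_all {Γ} σ (φ : fm (σ :: Γ)) : has_nf φ -> has_nf (All σ φ).
Proof.
  intros (ρ & τ & ψ & i & g & e); apply (has_nf_iff (iff_all e)).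
  { intros n h; now apply g, free_nf. }
  pose (χ := sub_fm (v0 .: v3 .: v1 .: ↑ >> (↑ >> (↑ >> ↑))) ψ
    : fm (τ :: σ :: Seq τ :: ρ :: Γ)).
  pose (θ := sub_fm (v0 .: v2 .: v1 .: ↑ >> (↑ >> ↑)) ψ : fm (τ :: σ :: ρ :: Γ)).
  exists ρ, (Seq τ), (All σ (Ex τ (And (Mem v0 v2) χ))); split; [|split].
  - cbn; repeat split; now apply internal_sub.
  - intros n [h | h].
    + apply free_mem in h; cbn in h; intuition; discriminate.
    + apply free_sub in h; destruct h as (τ' & x & h & f); revert h f; revert τ' x.
      var_cases. intros τ' x h f; injection f as <-. right; now right.
  - apply prv_andI; apply prv_impI; unfold χ.
    + apply prv_allStI, prv_raa; asimp.
      (* One [z] at which [ψ] fails for all standard [y]. *)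
      apply prv_exE with (σ := σ) (φ := AllSt τ (Neg θ)).
      * eapply prv_impE; [apply prv_axiom, ax_idealisation; now split; [apply internal_sub |]|].
        unfold θ; asimp; apply prv_allStI, prv_raa; asimp.
        eapply prv_negE; [hypn 2|].
        apply prv_exStI with (t := v0); [hyp|]; asimp; apply prv_allI, prv_raa; asimp.
        eapply prv_negE; [hypn 1|].
        apply prv_exI with (t := v0); asimp; apply prv_allI, prv_impI, prv_impI; asimp.
        eapply prv_negE; [hypn 2|].
        apply prv_exI with (t := v0); asimp; apply prv_andI; hyp.
      * unfold θ; asimp. spec 3 v0. spec 0 v1.
        eapply prv_exE; [refine (prv_impE _ _); [hypn 0 | hypn 4] |]; asimp.
        spec 3 v0.
        eapply prv_negE; [refine (prv_impE _ _); [hypn 0 | eapply prv_andE1; hypn 1]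
                         | eapply prv_andE2; hypn 1].
    + apply prv_allI, prv_allStI; asimp.
      spec 1 v0. eapply prv_exE; [refine (prv_impE _ _); [hypn 0 | hypn 1] |]; asimp.
      refine (prv_cut (prv_andE2 _) _); [hypn 0 |].
      spec 0 v2. eapply prv_exE; [hypn 0|]; asimp.
      apply prv_exStI with (t := v0); asimp; [| eta; eapply prv_andE2; hypn 0].
      apply st_mem with (Q := v1); [eapply prv_andE1; hypn 3 | eapply prv_andE1; hypn 0].
Qed.

(** With [p] and [q] standing for pairs, the new form is
    [∀st p ∃st q (ψ1(p1 p, q1 q) ∨ ψ2(p2 p, q2 q))]. If both disjuncts fail, at [x]
    and at [u] say, then the new form fails at the pair of [x] and [u]. *)
Lemma has_nf_or {Γ} (φ1 φ2 : fm Γ) : has_nf φ1 -> has_nf φ2 -> has_nf (Or φ1 φ2).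
Proof.
  intros (ρ1 & τ1 & ψ1 & i1 & g1 & e1) (ρ2 & τ2 & ψ2 & i2 & g2 & e2).
  apply (has_nf_iff (iff_or e1 e2)).
  { intros n [h | h]; [left | right]; now (apply g1 || apply g2); apply free_nf. }
  destruct (pairing ρ1 ρ2) as (ρ & pr & p1 & p2 & ep).
  destruct (pairing τ1 τ2) as (τ & qr & q1 & q2 & eq).
  pose (χ1 := sub_fm (cl q1 · v0 .: cl p1 · v1 .: ↑ >> ↑) ψ1 : fm (τ :: ρ :: Γ)).
  pose (χ2 := sub_fm (cl q2 · v0 .: cl p2 · v1 .: ↑ >> ↑) ψ2 : fm (τ :: ρ :: Γ)).
  exists ρ, τ, (Or χ1 χ2); split; [|split].
  - split; now apply internal_sub.
  - intros n [h | h]; [left | right];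
      apply free_sub in h; destruct h as (τ' & x & h & f); revert h f; revert τ' x;
      var_cases; try (intros _ [f | f]; [now apply occurs_cl in f | discriminate f]);
      intros τ' x h f; injection f as <-; right; now right.
  - apply prv_andI; apply prv_impI; unfold χ1, χ2.
    + apply prv_allStI; asimp. eapply prv_orE; [hypn 1 | |].
      * spec 0 (cl p1 · v0).
        eapply prv_exE; [refine (prv_impE _ _); [hypn 0 |] |].
        { apply st_app; [apply st_cl | hypn 2]. }
        (* The second component of [q] is arbitrary but standard. *)
        asimp. apply prv_exStI with (t := cl qr · v0 · cl (dflt τ2)).
        { apply st_app; [apply st_app; [apply st_cl|]|apply st_cl]. eapply prv_andE1; hypn 0. }
        asimp; apply prv_orI1.
        apply prv_replace with (s := v0); [assumption | symmetry; apply eq |].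
        eapply prv_andE2; hypn 0.
      * spec 0 (cl p2 · v0).
        eapply prv_exE; [refine (prv_impE _ _); [hypn 0 |] |].
        { apply st_app; [apply st_cl | hypn 2]. }
        asimp. apply prv_exStI with (t := cl qr · cl (dflt τ1) · v0).
        { apply st_app; [apply st_app; [apply st_cl|apply st_cl]|]. eapply prv_andE1; hypn 0. }
        asimp; apply prv_orI2.
        apply prv_replace with (s := v0); [assumption | symmetry; apply eq |].
        eapply prv_andE2; hypn 0.
    + apply prv_raa; asimp. eapply prv_negE; [hypn 0|].
      apply prv_orI1; asimp; apply prv_allStI, prv_raa; asimp.
      eapply prv_negE; [hypn 2|].
      apply prv_orI2; asimp; apply prv_allStI, prv_raa; asimp.
      spec 5 (cl pr · v1 · v0).
      eapply prv_exE; [refine (prv_impE _ _); [hypn 0 |] |].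
      { apply st_app; [apply st_app; [apply st_cl | hypn 4] | hypn 2]. }
      asimp. eapply prv_orE; [eapply prv_andE2; hypn 0 | |].
      * eapply prv_negE; [hypn 5|].
        apply prv_exStI with (t := cl q1 · v0); asimp.
        { apply st_app; [apply st_cl | eapply prv_andE1; hypn 1]. }
        apply prv_replace1 with (s := cl p1 · (cl pr · v2 · v1));
          [assumption | apply ep | asimp; hypn 0].
      * eapply prv_negE; [hypn 3|].
        apply prv_exStI with (t := cl q2 · v0); asimp.
        { apply st_app; [apply st_cl | eapply prv_andE1; hypn 1]. }
        apply prv_replace1 with (s := cl p2 · (cl pr · v2 · v1));
          [assumption | apply ep | asimp; hypn 0].
Qed.

Theorem formula_has_nf {Γ} (φ : fm Γ) : has_nf φ.
Proof.
  induction φ as [Γ | Γ σ s t | Γ σ t | Γ φ IHφ ψ IHψ | Γ φ IHφ ψ IHψ | Γ φ IHφ ψ IHψ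
                 | Γ σ φ IHφ | Γ σ φ IHφ].
  - now apply has_nf_internal.
  - now apply has_nf_internal.
  - apply has_nf_st.
  - apply has_nf_iff with (φ' := Or (Neg φ) ψ); [| cbn; tauto | now apply has_nf_or, IHψ; apply has_nf_neg].
    apply prv_andI; apply prv_impI.
    + apply prv_raa. eapply prv_negE; [hypn 0|]. apply prv_orI1, prv_impI.
      eapply prv_negE; [hypn 1|]. apply prv_orI2.
      refine (prv_impE _ _); [hypn 2 | hypn 0].
    + apply prv_impI. eapply prv_orE; [hypn 1 | | hypn 0].
      eapply prv_negE; [hypn 0 | hypn 1].
  - apply has_nf_iff with (φ' := Neg (Or (Neg φ) (Neg ψ)));
      [| cbn; tauto | apply has_nf_neg, has_nf_or; now apply has_nf_neg].
    apply prv_andI; apply prv_impI.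
    + apply prv_impI. eapply prv_orE; [hypn 0 | |].
      * eapply prv_negE; [hypn 0 | eapply prv_andE1; hypn 2].
      * eapply prv_negE; [hypn 0 | eapply prv_andE2; hypn 2].
    + apply prv_andI; apply prv_raa; (eapply prv_negE; [hypn 1|]).
      * apply prv_orI1; hypn 0.
      * apply prv_orI2; hypn 0.
  - now apply has_nf_or.
  - now apply has_nf_all.
  - apply has_nf_iff with (φ' := Neg (All σ (Neg φ)));
      [| cbn; tauto | now apply has_nf_neg, has_nf_all, has_nf_neg].
    apply prv_andI; apply prv_impI.
    + apply prv_impI. eapply prv_exE; [hypn 1|]; asimp.
      spec 1 v0. refine (prv_impE _ _); [hypn 0 | hypn 1].
    + apply prv_raa. eapply prv_negE; [hypn 1|]. apply prv_allI, prv_impI; asimp.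
      eapply prv_negE; [hypn 1|]. apply prv_exI with (t := v0); asimp; hypn 0.
Qed.

Theorem mainTheorem1 (Γ : ctx) (M : var Γ ty0) (A : fm (ty1 :: Γ)) (hA : internal A) :
  exists NF : fm Γ,
    normal_form NF
    /\ (forall n : nat, free n NF -> free n (LoebNull A (Var M)))
    /\ prv [] (Imp (SubUnit A)
                 (Imp (Neg (St (Var M)))
                      (Iff (LoebNull A (Var M)) NF))).
Proof.
  destruct (formula_has_nf (LoebNull A (Var M))) as (ρ & τ & ψ & i & f & e).
  exists (AllSt ρ (ExSt τ ψ)); split; [|split].
  - now exists [ρ], [τ], ψ.
  - intros n h; now apply f, free_nf.
  - apply prv_impI, prv_impI, prv_nil, e.
Qed.
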